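(* Let $k$ be an integer with $1\le k\le n-1$, let $s$ be a positive integer with $\gcd(s,n)=1$, and let $L_1,L_2\in\mathscr{L}_{n,q}[x]$. Then the adjoint code of $\mathcal{H}_{k,s}(L_1,L_2)$ is equivalent to $\mathcal{H}_{k,s}(L_2^{q^{n-sk}},L_1)$, where $L_2^{q^{n-sk}}$ denotes the linearized polynomial representing the map $c\mapsto L_2(c)^{q^{n-sk}}$ on $\mathbb{F}_{q^n}$, the exponent $n-sk$ being read modulo $n$.
   Context: Let $q=p^\lambda$ be a power of a prime $p$, and $n$ a positive integer. $\mathscr{L}_{n,q}[x]$ denotes the set of linearized polynomials $\sum_i a_i x^{q^i}$, $a_i\in\mathbb{F}_{q^n}$, modulo $x^{q^n}-x$; it is identified with the set of $\mathbb{F}_q$-linear maps $\mathbb{F}_{q^n}\to\mathbb{F}_{q^n}$. Exponents $q^j$ of $x$ are read with $j$ modulo $n$. For $L_1,L_2\in\mathscr{L}_{n,q}[x]$ and $s$ coprime to $n$, define the code $$\mathcal{H}_{k,s}(L_1,L_2)=\{L_1(a_0)x+a_1x^{q^s}+\cdots+a_{k-1}x^{q^{s(k-1)}}+L_2(a_0)x^{q^{sk}}: a_0,\dots,a_{k-1}\in\mathbb{F}_{q^n}\}\subseteq\mathscr{L}_{n,q}[x].$$ The adjoint of $f=\sum_{i=0}^{n-1}a_ix^{q^{si}}$ is $\hat f=\sum_{i=0}^{n-1}a_i^{q^{s(n-i)}}x^{q^{s(n-i)}}$, and the adjoint code of $\mathcal{C}$ is $\widehat{\mathcal{C}}=\{\hat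 f: f\in\mathcal{C}\}$. Two additive codes $\mathcal{C},\mathcal{C}'\subseteq\mathscr{L}_{n,q}[x]$ are equivalent if there exist bijective $\phi_1,\phi_2\in\mathscr{L}_{n,q}[x]$ and $\rho\in\mathrm{Aut}(\mathbb{F}_{q^n})$ such that $\mathcal{C}'=\{\phi_1\circ f^\rho\circ\phi_2: f\in\mathcal{C}\}$, where $f^\rho=\sum \rho(a_i)x^{q^i}$ for $f=\sum a_ix^{q^i}$. *)

(* Defs.v *)
From HB Require Import structures.
From mathcomp Require Import all_boot all_order all_algebra all_field.

Set Implicit Arguments.
Unset Strict Implicit.
Unset Printing Implicit Defensive.

Import GRing.Theory.
Local Open Scope ring_scope.

(* L plays the role of F_{q^n} (#|L| = q ^ n is a hypothesis of the theorem).
   In L[x] / (x^(q^n) - x) the powers 'qX ^+ (q ^ j) depend only on j mod n, so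
   exponents need no explicit reduction.  The size and monicity tests built
   into {poly %/ _} succeed as soon as 1 < q ^ n. *)
Notation qmodpoly L q n := {poly %/ ('X^(q ^ n) - 'X : {poly L})}.

Section LinearizedPolynomials.

Variables (L : finFieldType) (q n : nat).

Implicit Types (f g : qmodpoly L q n) (C : {set qmodpoly L q n}).

Definition linearized : {set qmodpoly L q n} :=
  [set \sum_(i < n) a i *: 'qX ^+ (q ^ i) | a : {ffun 'I_n -> L}].

(* Independent of the representative when #|L| = q ^ n. *)
Definition lin_eval f (c : L) : L := (f : {poly L}).[c].

(* Coefficient of x^(q^j), with j read modulo n. *)
Definition lin_coef f (j : nat) : L := (f : {poly L})`_(q ^ (j %% n)).

Definition lin_comp f g : qmodpoly L q n :=
  in_qpoly ('X^(q ^ n) - 'X) ((f : {poly L}) \Po (g : {poly L})).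

Definition lin_twist (rho : {rmorphism L -> L}) f : qmodpoly L q n :=
  \sum_(i < n) rho (lin_coef f i) *: 'qX ^+ (q ^ i).

(* For s coprime to n, f is the sum over i < n of
   lin_coef f (s * i) *: 'qX ^+ (q ^ (s * i)). *)
Definition adjoint (s : nat) f : qmodpoly L q n :=
  \sum_(i < n) (lin_coef f (s * i) ^+ (q ^ (s * (n - i))))
                 *: 'qX ^+ (q ^ (s * (n - i))).

Definition adjoint_code (s : nat) C : {set qmodpoly L q n} :=
  [set adjoint s f | f in C].

(* Meant for 0 < k, so that a`_0 is a genuine entry of a. *)
Definition Hcode (k s : nat) (L1 L2 : qmodpoly L q n) : {set qmodpoly L q n} :=
  [set lin_eval L1 a`_0 *: 'qX
       + \sum_(1 <= i < k) a`_i *: 'qX ^+ (q ^ (s * i))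
       + lin_eval L2 a`_0 *: 'qX ^+ (q ^ (s * k)) | a : k.-tuple L].

Definition code_equiv C C' : Prop :=
  exists (phi1 phi2 : qmodpoly L q n) (rho : {rmorphism L -> L}),
    [/\ phi1 \in linearized /\ bijective (lin_eval phi1),
        phi2 \in linearized /\ bijective (lin_eval phi2),
        bijective rho
      & C' = [set lin_comp phi1 (lin_comp (lin_twist rho f) phi2) | f in C]].

(* The residue of n - m modulo n, also when n < m. *)
Definition subn_mod (m : nat) : nat := (n - m %% n) %% n.

(* The power taken modulo x^(q^n) - x: for linearized f it is linearized, by
   additivity of Frobenius, and represents c |-> f(c)^(q^j) (lin_eval_frob). *)
Definition lin_frob f (j : nat) : qmodpoly L q n := f ^+ (q ^ j).

Hypotheses (cardL : #|L| = (q ^ n)%N).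

Lemma mk_monic_linmod :
  mk_monic ('X^(q ^ n) - 'X : {poly L}) = 'X^(q ^ n) - 'X.
Proof.
have q_gt1 : (1 < q ^ n)%N by rewrite -cardL card_finNzRing_gt1.
have szX : (size (- 'X : {poly L})%R < size ('X^(q ^ n) : {poly L})%R)%N.
  by rewrite size_polyN size_polyX size_polyXn ltnS.
rewrite /mk_monic size_polyDl // size_polyXn monicE lead_coefDl //.
by rewrite lead_coefXn eqxx andbT ltnS ltnW.
Qed.

Lemma lin_eval_in_qpoly (p : {poly L}) c :
  lin_eval (in_qpoly ('X^(q ^ n) - 'X) p) c = p.[c].
Proof.
rewrite /lin_eval /= mk_monic_linmod.
have hM : 'X^(q ^ n) - 'X \is @monic L.
  by rewrite -mk_monic_linmod monic_mk_monic.
rewrite {2}(Pdiv.RingMonic.rdivp_eq hM p) !hornerE.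
by rewrite -cardL expf_card subrr mulr0 add0r.
Qed.

Lemma lin_eval_comp f g c : lin_eval (lin_comp f g) c = lin_eval f (lin_eval g c).
Proof. by rewrite lin_eval_in_qpoly horner_comp. Qed.

Lemma lin_eval_frob f j c : lin_eval (lin_frob f j) c = lin_eval f c ^+ (q ^ j).
Proof.
rewrite /lin_frob; have -> : f = in_qpoly ('X^(q ^ n) - 'X) f.
  by apply: val_inj; rewrite /= Pdiv.CommonRing.rmodp_small // size_mk_monic.
by rewrite -rmorphXn !lin_eval_in_qpoly horner_exp.
Qed.

End LinearizedPolynomials.

(* Main.v *)
Require Import Defs.
From mathcomp Require Import all_boot all_order all_algebra.
From mathcomp Require Import all_field.

(** Taking adjoints sends the monomial of exponent [q^(s i)] to the one of
   exponent [q^(s (n - i))], and right composition with [x^(q^(s k))] moves the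
   latter to [q^(s (k - i))].  So the two ends are swapped: [L1 a_0] lands on
   [x^(q^(s k))] untouched, [L2 a_0] lands on [x] raised to the power
   [q^(s (n - k))], and the inner coefficients are reversed up to powers of
   Frobenius, which are bijections of [L].  Hence the equivalence holds with
   [phi1 = x], [rho = id], [phi2 = x^(q^(s k))]. *)

Section LinearizedTheory.

Set Implicit Arguments.
Unset Strict Implicit.

Import GRing.Theory.
Local Open Scope ring_scope.

Variables (L : finFieldType) (q n : nat).
Hypothesis cardL : #|L| = (q ^ n)%N.

Implicit Types (f g : qmodpoly L q n) (a b c : L).

Let n_gt0 : (0 < n)%N.
Proof. by have := card_finNzRing_gt1 L; rewrite cardL; case: n. Qed.

Let q_gt1 : (1 < q)%N.
Proof.
have := card_finNzRing_gt1 L; rewrite cardL; move: n_gt0.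
by case: q => [|[|//]] ?; rewrite ?exp1n // exp0n.
Qed.

Let expq_gt0 j : (0 < q ^ j)%N.
Proof. by rewrite expn_gt0 ltnW. Qed.

(** * Frobenius exponents modulo [n], and polynomials as maps on [L] *)

Lemma expf_q_modn c j : c ^+ (q ^ (j %% n)) = c ^+ (q ^ j).
Proof.
rewrite [in RHS](divn_eq j n) addnC expnD exprM.
elim: (j %/ n)%N => [|t IHt]; first by rewrite mul0n expr1.
by rewrite mulSn expnD exprM -cardL expf_card.
Qed.

Lemma eq_expf_q c i j : i = j %[mod n] -> c ^+ (q ^ i) = c ^+ (q ^ j).
Proof. by move=> eq_ij; rewrite -expf_q_modn eq_ij expf_q_modn. Qed.

Lemma lin_evalD f g c : lin_eval (f + g) c = lin_eval f c + lin_eval g c.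
Proof. by rewrite /lin_eval /= hornerD. Qed.

Lemma lin_evalZ a f c : lin_eval (a *: f) c = a * lin_eval f c.
Proof. by rewrite /lin_eval /= hornerZ. Qed.

Lemma lin_eval0 c : lin_eval (0 : qmodpoly L q n) c = 0.
Proof. by rewrite /lin_eval /= horner0. Qed.

Lemma lin_eval_sum (I : Type) (r : seq I) (P : pred I)
    (F : I -> qmodpoly L q n) c :
  lin_eval (\sum_(i <- r | P i) F i) c = \sum_(i <- r | P i) lin_eval (F i) c.
Proof.
by apply: (big_morph (fun f => lin_eval f c)) => [f g|]; rewrite (lin_evalD, lin_eval0).
Qed.

Lemma lin_eval_qXn m c : lin_eval ('qX ^+ m : qmodpoly L q n) c = c ^+ m.
Proof. by rewrite -rmorphXn lin_eval_in_qpoly // hornerXn. Qed.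

Lemma lin_eval_qX c : lin_eval ('qX : qmodpoly L q n) c = c.
Proof. by rewrite lin_eval_in_qpoly // hornerX. Qed.

Lemma size_mk_monic_linmod :
  size (mk_monic ('X^(q ^ n) - 'X : {poly L})) = (q ^ n).+1.
Proof.
rewrite mk_monic_linmod // size_polyDl size_polyXn // size_polyN size_polyX.
by rewrite ltnS -cardL card_finNzRing_gt1.
Qed.

(** A nonzero reduced representative of [f - g] has degree below [q ^ n], so it cannot vanish at all
    [q ^ n] elements of [L]. Identities between codewords can thus be checked pointwise. *)
Lemma lin_eval_inj f g : lin_eval f =1 lin_eval g -> f = g.
Proof.
move=> eq_fg; apply/eqP; rewrite -subr_eq0; apply: contraT => nz_fg.
have nz_p : ((f - g : qmodpoly L q n) : {poly L}) != 0 by [].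
have := max_poly_roots nz_p _ (enum_uniq L).
rewrite -cardE cardL => /(_ _)/wrap[].
  apply/allP => c _; rewrite rootE -/(lin_eval _ _) lin_evalD eq_fg.
  by rewrite -lin_evalD subrr lin_eval0.
by rewrite ltnNge -ltnS -size_mk_monic_linmod size_mk_monic.
Qed.

Lemma eq_qXn_q i j : i = j %[mod n] ->
  'qX ^+ (q ^ i) = 'qX ^+ (q ^ j) :> qmodpoly L q n.
Proof. by move=> eq_ij; apply: lin_eval_inj => c; rewrite !lin_eval_qXn; apply: eq_expf_q. Qed.

(** * Coefficients, twists and linearized monomials *)

Lemma lin_coefD f g j : lin_coef (f + g) j = lin_coef f j + lin_coef g j.
Proof. by rewrite /lin_coef /= coefD. Qed.

Lemma lin_coef0 j : lin_coef (0 : qmodpoly L q n) j = 0.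
Proof. by rewrite /lin_coef /= coef0. Qed.

Lemma lin_coefZqXn a i j :
  lin_coef (a *: 'qX ^+ (q ^ i) : qmodpoly L q n) j
    = if i == j %[mod n] then a else 0.
Proof.
(* With the exponent reduced below [n], the monomial has degree less than [q ^ n] and is its own
   remainder, so its coefficients can be read off. *)
rewrite -(@eq_qXn_q (i %% n)) ?modn_mod //.
rewrite /lin_coef /= coefZ -rmorphXn /= Pdiv.CommonRing.rmodp_small; last first.
  by rewrite size_mk_monic_linmod size_polyXn ltnS ltn_exp2l // ltn_pmod.
rewrite coefXn eqn_exp2l // eq_sym.
by case: eqP; rewrite (mulr1, mulr0).
Qed.

Section Twist.

Variable rho : {rmorphism L -> L}.

Lemma lin_twistD f g : lin_twist rho (f + g) = lin_twist rho f + lin_twist rho g.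
Proof.
rewrite /lin_twist -big_split; apply: eq_bigr => i _ /=.
by rewrite lin_coefD rmorphD scalerDl.
Qed.

Lemma lin_twist0 : lin_twist rho (0 : qmodpoly L q n) = 0.
Proof. by apply: big1 => i _; rewrite lin_coef0 rmorph0 scale0r. Qed.

Lemma lin_twistZqXn a j :
  lin_twist rho (a *: 'qX ^+ (q ^ j) : qmodpoly L q n)
    = rho a *: 'qX ^+ (q ^ j).
Proof.
rewrite /lin_twist (bigD1 (Ordinal (ltn_pmod j n_gt0))) //= big1 ?addr0.
  by rewrite lin_coefZqXn modn_mod eqxx (@eq_qXn_q (j %% n) j) ?modn_mod.
move=> i; rewrite -val_eqE /= => neq_ij.
by rewrite lin_coefZqXn (modn_small (ltn_ord i)) eq_sym (negPf neq_ij) rmorph0 scale0r.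
Qed.

End Twist.

(** Even for [idfun], a twist keeps only the coefficients at powers of [q]; an adjoint is a sum of
    such monomials, so nothing is lost. *)
Lemma lin_twist_id_adjoint s f : lin_twist idfun (adjoint s f) = adjoint s f.
Proof.
rewrite /adjoint (big_morph _ (lin_twistD idfun) (lin_twist0 idfun)).
by apply: eq_bigr => i _; rewrite lin_twistZqXn.
Qed.

Lemma linearized_qXn j : 'qX ^+ (q ^ j) \in linearized L q n.
Proof.
(* The twist of the monomial by the identity is already a sum over [i < n] of the required shape,
   whatever the size of [j]. *)
rewrite -[X in X \in _]scale1r -(lin_twistZqXn idfun); apply/imsetP.
exists [ffun i : 'I_n => idfun (lin_coef (1 *: 'qX ^+ (q ^ j) : qmodpoly L q n) i)] => //.
by apply: eq_bigr => i _; rewrite ffunE.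
Qed.

(** * Adjoints of monomials and of codewords *)

Section Adjoint.

Variable s : nat.
Hypotheses (coprime_sn : coprime s n) (q_pchar : [pchar L].-nat q).

Lemma adjointD f g : adjoint s (f + g) = adjoint s f + adjoint s g.
Proof.
rewrite /adjoint -big_split; apply: eq_bigr => i _ /=.
by rewrite lin_coefD exprDn_pchar ?scalerDl // pnatX q_pchar.
Qed.

Lemma adjoint0 : adjoint s (0 : qmodpoly L q n) = 0.
Proof.
by apply: big1 => i _; rewrite lin_coef0 expr0n -[_ == _]negbK -lt0n expq_gt0 scale0r.
Qed.

(** Since [s] is invertible modulo [n], the exponents [s * i] for [i < n] are distinct residues;
    hence a single term survives in the adjoint of a monomial. *)
Lemma eqn_mul2l_coprime i j : (i < n)%N -> (j < n)%N ->
  (s * i == s * j %[mod n])%N = (i == j).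
Proof.
wlog le_ij : i j / (i <= j)%N => [IH lt_i lt_j|lt_i lt_j].
  case/orP: (leq_total i j) => le; first exact: IH.
  by rewrite eq_sym [RHS]eq_sym IH.
rewrite eq_sym eqn_mod_dvd ?leq_mul2l ?le_ij ?orbT // -mulnBr.
rewrite Gauss_dvdr 1?coprime_sym // -eqn_mod_dvd // !modn_small //.
Qed.

Lemma adjointZqXn a i : (i < n)%N ->
  adjoint s (a *: 'qX ^+ (q ^ (s * i)) : qmodpoly L q n)
    = a ^+ (q ^ (s * (n - i))) *: 'qX ^+ (q ^ (s * (n - i))).
Proof.
move=> lt_in; rewrite /adjoint (bigD1 (Ordinal lt_in)) //= big1 ?addr0.
  by rewrite lin_coefZqXn eqxx.
move=> j; rewrite -val_eqE /= => neq_ij.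
rewrite lin_coefZqXn eqn_mul2l_coprime // eq_sym (negPf neq_ij).
by rewrite expr0n -[_ == _]negbK -lt0n expq_gt0 scale0r.
Qed.

(* The inner sum is reversed by [i |-> k - i], to match the monomials of the
   code on the other side. *)
Lemma lin_eval_adjoint_codeword k (u v c : L) (a : nat -> L) : (0 < k < n)%N ->
  lin_eval (adjoint s (u *: 'qX + \sum_(1 <= i < k) a i *: 'qX ^+ (q ^ (s * i))
                      + v *: 'qX ^+ (q ^ (s * k)) : qmodpoly L q n))
           (c ^+ (q ^ (s * k)))
  = v ^+ (q ^ (s * (n - k))) * c
    + \sum_(1 <= i < k) a (k - i)%N ^+ (q ^ (s * (n - (k - i))))
                          * c ^+ (q ^ (s * i))
    + u * c ^+ (q ^ (s * k)).
Proof.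
case/andP=> k_gt0 lt_kn.
have frob_shift i : (i <= k)%N ->
    (c ^+ (q ^ (s * k))) ^+ (q ^ (s * (n - i))) = c ^+ (q ^ (s * (k - i))).
  move=> le_ik; rewrite -exprM -expnD -mulnDr; apply: eq_expf_q.
  have -> : (k + (n - i) = n + (k - i))%N.
    by rewrite !addnBA ?(leq_trans le_ik (ltnW lt_kn)) // addnC.
  by rewrite mulnDr modnMDl.
(* The head is the monomial of index 0. Its adjoint carries the Frobenius exponent [s * n], which is
   0 modulo [n], so [u] comes out unchanged. *)
have qX0 : 'qX = 'qX ^+ (q ^ (s * 0)) :> qmodpoly L q n by rewrite muln0 expn0 expr1.
rewrite {1}qX0 !adjointD //.
rewrite (big_morph _ adjointD adjoint0).
rewrite !adjointZqXn //.
rewrite !lin_evalD !lin_evalZ !lin_eval_qXn lin_eval_sum.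
rewrite !frob_shift // subnn muln0 expn0 expr1 !subn0 (@eq_expf_q u _ 0); last first.
  by rewrite modnMl mod0n.
rewrite expn0 expr1 [LHS]addrC [X in _ + X = _]addrC addrA.
congr (_ + _ + _); rewrite [RHS]big_nat_rev; apply: eq_big_nat => i /andP[_ lt_ik].
rewrite adjointZqXn ?(ltn_trans lt_ik) // lin_evalZ lin_eval_qXn.
by rewrite frob_shift 1?ltnW // add1n subSS subKn // ltnW.
Qed.

End Adjoint.

(** Adding [s * k] turns both sides into multiples of [n]. This matches the exponent in the target
    code with the one that the adjoint produces. *)
Lemma subn_mod_mulE s k : (k <= n)%N -> subn_mod n (s * k) = s * (n - k) %[mod n].
Proof.
move=> le_kn; rewrite /subn_mod modn_mod; apply/eqP.
rewrite -(eqn_modDr (s * k %% n)) subnK 1?ltnW ?ltn_pmod //.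
by rewrite modnDmr -mulnDr subnK // modnn modnMl.
Qed.

Lemma bijective_lin_eval_qXn_q j :
  bijective (lin_eval ('qX ^+ (q ^ j) : qmodpoly L q n)).
Proof.
apply: injF_bij => x y; rewrite !lin_eval_qXn => eq_xy.
(* The two exponents add up to [j * n], a trivial power of Frobenius. *)
have frobK (c : L) : (c ^+ (q ^ j)) ^+ (q ^ (j * n.-1)) = c.
  rewrite -exprM -expnD -mulnS prednK // (@eq_expf_q c _ 0) ?expr1 //.
  by rewrite modnMl mod0n.
by rewrite -(frobK x) eq_xy frobK.
Qed.

End LinearizedTheory.

Theorem proposition2p4 (p lambda q n : nat) (L : finFieldType)
    (p_prime : prime p) (lambda_gt0 : (0 < lambda)%N) (qE : q = (p ^ lambda)%N)
    (n_gt0 : (0 < n)%N) (cardL : #|L| = (q ^ n)%N)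
    (k s : nat) (k_range : (1 <= k <= n - 1)%N)
    (s_gt0 : (0 < s)%N) (coprime_sn : coprime s n)
    (L1 L2 : qmodpoly L q n)
    (L1_lin : L1 \in linearized L q n) (L2_lin : L2 \in linearized L q n) :
  code_equiv (adjoint_code s (Hcode k s L1 L2))
             (Hcode k s (lin_frob L2 (subn_mod n (s * k))) L1).
Proof.
have /andP[k_gt0 le_kn1] := k_range.
have lt_kn : (k < n)%N by rewrite -(prednK n_gt0) ltnS -subn1.
have p_pchar : p \in [pchar L]%R.
  by apply: (@card_finPcharP _ _ (lambda * n)); rewrite // cardL qE expnM.
have q_pchar : ([pchar L]%R).-nat q.
  by rewrite qE pnatX pnatE // p_pchar.
(* Entries of the target codeword in terms of those of the source. Index 0 is set apart: [a 0] feeds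
   both ends and is kept, while [k - 0] would fall outside the tuple. *)
pose twist (a : nat -> L) i :=
  if i == 0 then a 0 else (a (k - i)%N ^+ (q ^ (s * (n - (k - i)))))%R.
pose codeword (M1 M2 : qmodpoly L q n) (a : k.-tuple L) : qmodpoly L q n :=
  (lin_eval M1 a`_0 *: 'qX + \sum_(1 <= i < k) a`_i *: 'qX ^+ (q ^ (s * i))
   + lin_eval M2 a`_0 *: 'qX ^+ (q ^ (s * k)))%R.
(* This single identity serves both inclusions. *)
have transfer (a b : k.-tuple L) :
    (forall i, i < k -> nth 0%R b i = twist (nth 0%R a) i) ->
  codeword (lin_frob L2 (subn_mod n (s * k))) L1 b
  = lin_comp 'qX%R (lin_comp (lin_twist idfun (adjoint s (codeword L1 L2 a)))
                             ('qX ^+ (q ^ (s * k)))%R).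
  move=> eq_b; apply: (lin_eval_inj cardL) => c.
  rewrite !lin_eval_comp // lin_twist_id_adjoint // lin_eval_qX // lin_eval_qXn //.
  rewrite (lin_eval_adjoint_codeword cardL coprime_sn q_pchar) ?k_gt0 //.
  rewrite !lin_evalD !lin_evalZ lin_eval_qXn // lin_eval_qX // lin_eval_sum.
  rewrite lin_eval_frob // eq_b //.
  rewrite (eq_expf_q cardL _ (subn_mod_mulE cardL s (ltnW lt_kn))).
  congr (_ + _ + _)%R; apply: eq_big_nat => i /andP[i_gt0 lt_ik].
  by rewrite lin_evalZ lin_eval_qXn // eq_b // /twist -[i == 0]negbK -lt0n i_gt0.
exists 'qX%R, ('qX ^+ (q ^ (s * k)))%R, idfun; split.
(* ['qX] is the monomial of exponent [q ^ 0]. *)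
- have := linearized_qXn cardL 0; have := bijective_lin_eval_qXn_q cardL 0.
  by rewrite expn0 GRing.expr1.
- by split; [exact: linearized_qXn | exact: bijective_lin_eval_qXn_q].
- by exists idfun.
apply/setP => g; apply/imsetP/imsetP.
  case=> b _ ->.
  (* The preimage of [b] under [twist]: at index [k - i] the exponents [s * (k - i)] and
     [s * (n - (k - i))] add up to [s * n], so [b] is recovered. *)
  pose a := [tuple if val i == 0 then nth 0%R b 0
                   else (nth 0%R b (k - i)%N ^+ (q ^ (s * i)))%R | i < k].
  have aE i : i < k -> nth 0%R a i
      = if i == 0 then nth 0%R b 0 else (nth 0%R b (k - i)%N ^+ (q ^ (s * i)))%R.
    by move=> lt_ik; rewrite (nth_mktuple _ 0%R (Ordinal lt_ik)).
  eexists; last apply: (transfer a).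
    by apply: imset_f; apply: imset_f.
  move=> i lt_ik; rewrite /twist aE //; case: (posnP i) => [->//|i_gt0].
  have lt_kik : k - i < k by rewrite ltn_subrL i_gt0 k_gt0.
  rewrite aE // -[k - i == 0]negbK -lt0n subn_gt0 lt_ik /= subKn 1?ltnW //.
  rewrite -GRing.exprM -expnD -mulnDr subnKC ?(ltnW (ltn_trans lt_kik lt_kn)) //.
  rewrite (@eq_expf_q _ _ _ cardL _ _ 0) ?GRing.expr1 //.
  by rewrite modnMl mod0n.
case=> _ /imsetP[_ /imsetP[a _ ->] ->] ->.
exists [tuple twist (nth 0%R a) i | i < k] => //.
apply/esym/(transfer a) => i lt_ik.
by rewrite (nth_mktuple _ 0%R (Ordinal lt_ik)).
Qed.
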